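(* Consider an instance of the VRPRB (the bi-objective capacitated vehicle routing problem minimizing the total tour length $C(\mathbf{x})$ and an inequality measure $I(\mathbf{x})$ of the tour lengths). If $I(\mathbf{x})$ is at least weakly monotonic, then the Pareto-optimal solutions of the VRPRB cannot be inconsistent.
   Context: Capacitated vehicle routing problem (CVRP): given a depot, a finite set of customers with nonnegative demands, nonnegative travel distances between all pairs of locations, a vehicle capacity, and a number $n \ge 2$ of tours. A feasible solution is a collection of $n$ tours, each starting and ending at the depot, such that every customer is visited exactly once by exactly one tour, and the total demand of the customers in each tour does not exceed the capacity. The length of a tour is the sum of the distances travelled along it. A solution is characterized, for the evaluation of the objectives, by the vector $\mathbf{x} = (x_1,\dots,x_n)$ of its workloads, where $x_i$ is the length of its $i$-th tour. $X$ denotes the set of feasible solutions (allocations). The total cost is $C(\mathbf{x}) = \sum_{i=1}^n x_i$. An inequality measure is a function $I$ assigning a real index value $I(\mathbf{x})$ to each allocation $\mathbf{x}\in X$ (a function of the workload vector); smaller is more equitable. The VRPRB is the bi-objective problem of minimizing $C$ and $I$ over $X$. Pareto-optimality: $\mathbf{x}'$ dominates $\mathbf{x}$ if $C(\mathbf{x}') \le C(\mathbf{x})$ and $I(\mathbf{x}') \le I(\mathbf{x})$ with at least one of the two inequalities strict; $\mathbf{x} \in X$ is Pareto-optimal if no $\mathbf{x}' \in X$ dominates it. Weak monotonicity: $I$ is (at least weakly) monotonic if, whenever $\mathbf{x}'$ is formed from $\mathbf{x}$ by $x'_i = x_i + \delta_i$ with $\delta_i \ge 0$ for all $i$ and $\delta_i>0$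 for at least one $i$, then $I(\mathbf{x}') \ge I(\mathbf{x})$. Inconsistency: a solution $\mathbf{x}\in X$ is inconsistent if there exists another solution $\mathbf{x}' \in X$ such that $C(\mathbf{x}) > C(\mathbf{x}')$ and $x_i \ge x'_i$ for all $i \in \{1,\dots,n\}$, but $I(\mathbf{x}) < I(\mathbf{x}')$. *)

(* Defs.v *)
From HB Require Import structures.
From mathcomp Require Import all_boot all_order all_algebra.

Set Implicit Arguments.
Unset Strict Implicit.
Unset Printing Implicit Defensive.

Import Order.TTheory GRing.Theory Num.Theory.
Local Open Scope ring_scope.

(* Locations are [option customer], with [None] the depot. Distances need not
   be symmetric, satisfy the triangle inequality, or vanish on the diagonal. *)
Record cvrp (R : realFieldType) := Cvrp {
  customer : finType;
  demand : customer -> R;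
  dist : option customer -> option customer -> R;
  capacity : R;
  ntours : nat;
  demand_ge0 : forall c, 0 <= demand c;
  dist_ge0 : forall u v, 0 <= dist u v;
  ntours_ge2 : (2 <= ntours)%N
}.

Section Routing.
Variables (R : realFieldType) (P : cvrp R).

(* A tour is the sequence of its customers in order of visit; the departure
   from and the return to the depot are left implicit. *)
Definition tour : Type := seq (customer P).

Definition solution : Type := 'I_(ntours P) -> tour.

(* Sum over the consecutive pairs of the closed walk depot, t, depot. *)
Definition tour_length (t : tour) : R :=
  let stops := [seq Some c | c <- t] in
  \sum_(e <- zip (None :: stops) (rcons stops None)) dist e.1 e.2.

Definition feasible (s : solution) : Prop :=
  [/\ forall c : customer P, exists! i : 'I_(ntours P), c \in s i,
      forall i, uniq (s i)
    & forall i, \sum_(c <- s i) demand c <= capacity P].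

Definition workload (s : solution) : 'rV[R]_(ntours P) :=
  \row_i tour_length (s i).

Definition total_cost (x : 'rV[R]_(ntours P)) : R := \sum_i x 0 i.

(* Only the values of a measure at workloads of feasible solutions are used
   below, so a total function stands for one defined on those alone. *)
Definition inequality_measure : Type := 'rV[R]_(ntours P) -> R.

Variable I : inequality_measure.

Definition weakly_monotonic : Prop :=
  forall s s' : solution, feasible s -> feasible s' ->
  forall delta : 'rV[R]_(ntours P),
    (forall i, 0 <= delta 0 i) ->
    (exists i, 0 < delta 0 i) ->
    (forall i, workload s' 0 i = workload s 0 i + delta 0 i) ->
    I (workload s) <= I (workload s').

Definition dominates (s' s : solution) : Prop :=
  let x' := workload s' in let x := workload s in
  [/\ total_cost x' <= total_cost x,
      I x' <= I x
    & total_cost x' < total_cost x \/ I x' < I x].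

Definition pareto_optimal (s : solution) : Prop :=
  feasible s /\ ~ (exists s' : solution, feasible s' /\ dominates s' s).

Definition inconsistent (s : solution) : Prop :=
  feasible s /\
  exists s' : solution,
    let x' := workload s' in let x := workload s in
    [/\ feasible s',
        total_cost x' < total_cost x,
        forall i, x' 0 i <= x 0 i
      & I x < I x'].

End Routing.

(* Main.v *)
Require Import Defs.
From HB Require Import structures.
From mathcomp Require Import all_boot all_order all_algebra.

(** If x' <= x componentwise and x' has the smaller total cost, then some
    workload strictly decreases, since otherwise the totals would compare the
    other way. Hence x arises from x' by the increments x - x', which are
    nonnegative and not all zero, and weak monotonicity gives I x' <= I x.
    This contradicts the inequality I x < I x' that inconsistency demands. *)

Import Order.TTheory GRing.Theory Num.Theory.
Local Open Scope ring_scope.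

Lemma total_cost_lt_exists (R : realFieldType) (P : cvrp R)
    (x y : 'rV[R]_(ntours P)) :
  total_cost x < total_cost y -> exists i, x 0 i < y 0 i.
Proof.
move=> lt_xy; apply/existsP; apply: contraLR lt_xy => /existsPn le_yx.
by rewrite -leNgt; apply: ler_sum => i _; rewrite leNgt.
Qed.

Theorem theorem2 (R : realFieldType) (P : cvrp R) (I : inequality_measure P) :
  weakly_monotonic I ->
  forall s : solution P, pareto_optimal I s -> ~ inconsistent I s.
Proof.
move=> I_mono s _ [s_feas [s' [s'_feas lt_cost le_work]]].
apply/negP; rewrite -leNgt.
apply: (I_mono s' s s'_feas s_feas (workload s - workload s')) => [i||i].
- by have := le_work i; rewrite -subr_ge0 !mxE.
- have [i lt_i] := total_cost_lt_exists _ _ _ _ lt_cost.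
  by exists i; move: lt_i; rewrite -subr_gt0 !mxE.
- by rewrite !mxE [RHS]addrC subrK.
Qed.
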